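(* Let $V$ be a subvariety of $\mathbb{C}^{2^n-1}$, where $\mathbb{C}^{2^n-1}$ has coordinates the cumulants $k_I$, $\emptyset\ne I\subseteq[n]$. Then $V$ is invariant under all changes of the values of the binary variables $X_i$ (i.e. under all transformations $k_I\mapsto k_I\prod_{i\in I}(a_i-b_i)$ for $|I|\ge2$ and $k_i\mapsto (a_i-b_i)k_i+b_i$ for $i\in[n]$, for all complex $a_i,b_i$) if and only if $V$ is defined by polynomials in the higher cumulants $k_I$, $|I|\ge 2$, that are homogeneous with respect to the $\mathbb{Z}^n$-grading $\deg(k_I)=\sum_{i\in I}e_i$.
   Context: For a complex table $P=(p_I)_{I\subseteq[n]}$ with $\sum_I p_I=1$, the moments are $\mu_I=\sum_{J\supseteq I}p_J$ and the cumulants $k_I$ are the coefficients of $\log\big(\sum_I\mu_I\prod_{i\in I}x_i\big)$ computed modulo $\langle x_1^2,\ldots,x_n^2\rangle$; equivalently $k_I=\sum_{\pi\in\Pi(I)}(-1)^{|\pi|-1}(|\pi|-1)!\prod_{B\in\pi}\mu_B$, with $\Pi(I)$ the set partitions of $I$. The cumulants give coordinates on the space of such tables. Interpreting $P$ as the distribution of a vector $X=(X_1,\ldots,X_n)$ with values in $\{0,1\}^n$, replacing the values $1,0$ of $X_i$ by $a_i,b_i$ (keeping the same distribution) transforms the cumulants as $k_I'=k_I\prod_{i\in I}(a_i-b_i)$ for $|I|\ge2$ and $k_i'=(a_i-b_i)k_i+b_i$. $e_i$ denotes the $i$-th unit vector of $\mathbb{Z}^n$. *)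

(* Defs.v *)
From HB Require Import structures.
From mathcomp Require Import all_boot all_order all_algebra.
From mathcomp Require Import mpoly complex.
From mathcomp Require Import classical_sets reals.

Set Implicit Arguments.
Unset Strict Implicit.
Unset Printing Implicit Defensive.

Import GRing.Theory.
Local Open Scope ring_scope.
Local Open Scope classical_set_scope.

Section CumulantSpace.
Variables (R : realType) (n : nat).

Definition cidx := {I : {set 'I_n} | I != finset.set0}.

Lemma card_cidx : #|{: cidx}| = (2 ^ n - 1)%N.
Proof.
have -> : #|{: cidx}| = #|predC1 (finset.set0 : {set 'I_n})|.
  by rewrite card_sig; apply: eq_card.
by rewrite cardC1 -cardsT -powersetT card_powerset cardsT card_ord subn1.
Qed.

Definition cspace := {ffun cidx -> R[i]}.

(* {mpoly K[m]} has its variables indexed by 'I_m, so the nonempty subsets are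
   enumerated: the variable 'X_j stands for the coordinate k_(enum_val j). *)
Definition cpoly := {mpoly R[i][#|{: cidx}|]}.

Definition ceval (k : cspace) (f : cpoly) : R[i] :=
  f.@[fun j => k (enum_val j)].

Definition zero_locus (S : set cpoly) : set cspace :=
  [set k | forall f, S f -> ceval k f = 0].

Definition subvariety (V : set cspace) : Prop :=
  exists S : set cpoly, V = zero_locus S.

(* [unset1 I] is [Some i] when I = {i}, and [None] when |I| >= 2. *)
Definition change_values (a b : 'I_n -> R[i]) (k : cspace) : cspace :=
  [ffun I : cidx =>
     if unset1 (val I) is Some i then (a i - b i) * k I + b i
     else k I * \prod_(i in val I) (a i - b i)].

(* Invariance is the inclusion of the image in V: when a i = b i for some i the
   transformation is not bijective, and its image need not be all of V. *)
Definition value_invariant (V : set cspace) : Prop :=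
  forall a b : 'I_n -> R[i], change_values a b @` V `<=` V.

Definition in_higher_cumulants (f : cpoly) : Prop :=
  forall m, m \in msupp f ->
  forall j, m j != 0%N -> (2 <= #|val (enum_val j : cidx)|)%N.

Definition cdeg (I : cidx) : 'rV[int]_n := \sum_(i in val I) delta_mx 0 i.

Definition mcdeg (m : 'X_{1..#|{: cidx}|}) : 'rV[int]_n :=
  \sum_j cdeg (enum_val j) *+ m j.

Definition chomogeneous (f : cpoly) : Prop :=
  exists d : 'rV[int]_n, forall m, m \in msupp f -> mcdeg m = d.

End CumulantSpace.

(* Main.v *)
Require Import Defs.
From HB Require Import structures.
From mathcomp Require Import all_boot all_order all_algebra.
From mathcomp Require Import mpoly complex.
From mathcomp Require Import classical_sets reals.

(** A change of values with [a i - b i = t i] rescales a monomial in the higher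
cumulants of multidegree [d] by [\prod_i t i ^+ d i], and translates the first
cumulants arbitrarily.  Homogeneous polynomials in the higher cumulants
therefore have invariant zero loci.  Conversely, if [V] is invariant and [f]
vanishes on [V], then translating the first cumulants to [0] and rescaling by
all [t] gives a polynomial in [t] that vanishes identically; its coefficients
are the values of the multihomogeneous components of [f], restricted to the
monomials in the higher cumulants.  So these components vanish on [V], and they
cut out [V] since the first cumulants can be translated back from [0]. *)

Set Implicit Arguments.
Unset Strict Implicit.
Unset Printing Implicit Defensive.

Import GRing.Theory Num.Theory.
Local Open Scope ring_scope.

(** In characteristic zero the integers below [size p] are distinct roots, too many for a nonzero
    [p]. *)
Lemma poly_eq0_horner (F : numFieldType) (p : {poly F}) :
  (forall x, p.[x] = 0) -> p = 0.
Proof.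
move=> p0; pose rs : seq F := [seq i%:R | i <- iota 0 (size p)].
apply: (@roots_geq_poly_eq0 _ _ rs); last by rewrite size_map size_iota.
  by apply/allP => x _; rewrite rootE p0.
by rewrite map_inj_uniq ?iota_uniq // => i j /eqP; rewrite eqr_nat => /eqP.
Qed.

(** The conclusion concerns one coefficient of a polynomial function of [t] that vanishes
    identically; several [m] may share an exponent, hence a sum. *)
Lemma monomial_sum_fiber_eq0 (F : numFieldType) (n : nat) (T : Type)
    (s : seq T) (P : pred T) (e : T -> {ffun 'I_n -> nat}) (c : T -> F)
    (d : {ffun 'I_n -> nat}) :
  (forall t : 'I_n -> F,
     \sum_(m <- s | P m) c m * \prod_i t i ^+ e m i = 0) ->
  \sum_(m <- s | P m && (e m == d)) c m = 0.
Proof.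
move=> H.
(* The exponents are fixed one coordinate at a time. *)
have {}H (l : seq 'I_n) : forall t : 'I_n -> F,
    \sum_(m <- s | P m && all (fun i => e m i == d i) l)
      c m * \prod_(i | i \notin l) t i ^+ e m i = 0.
  elim: l => [|i l IH] t.
    by rewrite -[RHS](H t); apply: eq_big => [m|m _]; rewrite ?andbT.
  have [il|il] := boolP (i \in l).
    rewrite -[RHS](IH t); apply: eq_big => [m|m _].
      congr (_ && _) => /=; case: (boolP (all _ l)) => [/allP/(_ i il) -> //|].
      by rewrite andbF.
    congr (_ * _); apply: eq_bigl => j; rewrite inE.
    by case: eqVneq => // ->; rewrite il.
  (* With the other [t j] frozen, [IH] says that [p] vanishes at every value of [t i]; its
     coefficient of degree [d i] is the sum for [i :: l]. *)
  pose w m := c m * \prod_(j | j \notin i :: l) t j ^+ e m j.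
  pose p : {poly F} := \sum_(m <- s | P m && all (fun i => e m i == d i) l)
    w m *: 'X^(e m i).
  have p0 : p = 0.
    apply: poly_eq0_horner => x; rewrite horner_sum.
    rewrite -[RHS](IH (fun j => if j == i then x else t j)).
    apply: eq_bigr => m _; rewrite hornerZ hornerXn /w -mulrA; congr (_ * _).
    rewrite [RHS](bigD1 i) //= eqxx mulrC; congr (_ * _).
    apply: eq_big => [j|j]; first by rewrite inE negb_or andbC.
    by rewrite inE negb_or => /andP[/negbTE ->].
  have /(congr1 (fun q : {poly F} => q`_(d i))) := p0.
  rewrite coef0 coef_sum => E; rewrite -[RHS]E /= [RHS]big_mkcond.
  rewrite [LHS]big_mkcond; apply: eq_bigr => m _.
  rewrite coefZ coefXn (eq_sym (d i)); case: (P m) => //=; case: (e m i == d i) => /=.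
    by case: ifP => // _; rewrite mulr1.
  by rewrite mulr0; case: ifP.
rewrite -[RHS](H (enum 'I_n) (fun=> 1)); apply: eq_big => [m|m _].
  congr (_ && _); apply/eqP/allP => [-> //|E].
  by apply/ffunP => i; apply/eqP/E; rewrite mem_enum.
by rewrite big1 ?mulr1 // => i _; rewrite expr1n.
Qed.

Lemma sum_fibers_eq0 (V : nmodType) (T D : eqType) (s : seq T) (P : pred T)
    (h : T -> D) (F : T -> V) :
  (forall d, \sum_(m <- s | P m && (h m == d)) F m = 0) ->
  \sum_(m <- s | P m) F m = 0.
Proof.
move=> H; transitivity (\sum_(d <- undup (map h s))
    \sum_(m <- s | P m && (h m == d)) F m); last first.
  by apply: big1 => d _; apply: H.
rewrite (exchange_big_dep P) /= => [|d m _ /andP[] //].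
rewrite big_seq_cond [RHS]big_seq_cond; apply: eq_bigr => m /andP[ms Pm].
rewrite Pm /= -big_filter (_ : filter _ _ = [:: h m]) ?big_seq1 //.
rewrite (eq_filter (a2 := pred1 (h m))) => [|x]; last by rewrite /= eq_sym.
by rewrite filter_pred1_uniq ?undup_uniq // mem_undup map_f.
Qed.

Section HigherCumulants.
Variables (R : realType) (n : nat).
Implicit Types (k : cspace R n) (f : cpoly R n) (a b : 'I_n -> R[i]).
Implicit Types (m : 'X_{1..#|{: cidx n}|}).

Definition higher_monom m : bool :=
  [forall j, (m j != 0%N) ==> (2 <= #|val (enum_val j : cidx n)|)%N].

(** The multidegree with natural entries, usable as exponents. *)
Definition mndeg m : {ffun 'I_n -> nat} :=
  [ffun i => (\sum_(j | i \in val (enum_val j : cidx n)) m j)%N].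

Lemma mcdegE m : mcdeg m = \row_i (mndeg m i)%:Z.
Proof.
apply/rowP => i; rewrite /mcdeg summxE mxE ffunE -natz natr_sum [RHS]big_mkcond /=.
apply: eq_bigr => j _; rewrite mulmxnE /cdeg summxE.
have -> : \sum_(i0 in val (enum_val j : cidx n)) (delta_mx 0 i0 : 'rV[int]_n) 0 i
   = (i \in val (enum_val j : cidx n))%:R.
  case: (boolP (i \in _)) => iI.
    rewrite (bigD1 i) //= mxE !eqxx big1 ?addr0 // => i0 /andP[_ ne].
    by rewrite mxE eq_sym (negbTE ne) andbF.
  rewrite big1 // => i0 i0I; rewrite mxE; case: (eqVneq i i0) => // E.
  by rewrite E i0I in iI.
by case: ifP => _; rewrite ?mul0rn.
Qed.

Lemma mndeg_mcdeg m m' : mcdeg m = mcdeg m' -> mndeg m = mndeg m'.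
Proof.
by move=> E; apply/ffunP => i; move/rowP: E => /(_ i); rewrite !mcdegE !mxE => -[].
Qed.

Definition cmon k m : R[i] := \prod_j k (enum_val j) ^+ m j.

Lemma cevalE k f : ceval k f = \sum_(m <- msupp f) f@_m * cmon k m.
Proof. exact: mevalE. Qed.

Lemma set1_neq0 (i : 'I_n) : [set i]%SET != finset.set0.
Proof. by rewrite -card_gt0 cards1. Qed.

Definition singleton_cidx (i : 'I_n) : cidx n :=
  exist _ [set i]%SET (set1_neq0 i).

Lemma change_values1 a b k i :
  change_values a b k (singleton_cidx i) =
  (a i - b i) * k (singleton_cidx i) + b i.
Proof. by rewrite ffunE /= set1K. Qed.

Lemma change_values_higher a b k (I : cidx n) : (2 <= #|val I|)%N ->
  change_values a b k I = k I * \prod_(i in val I) (a i - b i).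
Proof. by move=> hI; rewrite ffunE unset1N1 // neq_ltn hI orbT. Qed.

Lemma cidxP (I : cidx n) : (exists i, I = singleton_cidx i) \/ (2 <= #|val I|)%N.
Proof.
case: (ltnP 1 #|val I|) => hI; [by right | left].
have : #|val I| == 1%N by rewrite eqn_leq hI card_gt0 (valP I).
by move=> /cards1P[i Ii]; exists i; apply: val_inj.
Qed.

(** Each factor [k I] with [i] in [I] contributes one [a i - b i], so these factors add up to the
    multidegree. *)
Lemma cmon_change a b k m : higher_monom m ->
  cmon (change_values a b k) m =
  cmon k m * \prod_i (a i - b i) ^+ mndeg m i.
Proof.
move=> /forallP hm.
transitivity (\prod_j (k (enum_val j) ^+ m j *
    \prod_(i in val (enum_val j : cidx n)) (a i - b i) ^+ m j)).
  apply: eq_bigr => j _; have [->|mj] := eqVneq (m j) 0%N.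
    by rewrite !expr0 mul1r big1.
  by rewrite change_values_higher ?(implyP (hm j)) // exprMn prodrXl.
rewrite big_split /=; congr (_ * _).
rewrite (exchange_big_dep xpredT) //=; apply: eq_bigr => i _.
by rewrite ffunE -expr_sum.
Qed.

Lemma cmon_eq0 k m : (forall i, k (singleton_cidx i) = 0) ->
  ~~ higher_monom m -> cmon k m = 0.
Proof.
move=> k0 /forallPn[j]; rewrite negb_imply => /andP[mj hj].
apply/eqP/prodf_eq0; exists j => //.
case: (cidxP (enum_val j)) => [[i ->]|]; last by rewrite (negbTE hj).
by rewrite k0 expr0n (negbTE mj).
Qed.

(** The values have difference [t i], and the shift cancels the scaled first cumulant. They depend
    on [k], which is harmless as invariance is used pointwise. *)
Definition scale_higher (t : 'I_n -> R[i]) k : cspace R n :=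
  change_values (fun i => t i - t i * k (singleton_cidx i))
    (fun i => - (t i * k (singleton_cidx i))) k.

Lemma ceval_scale_higher t k f :
  ceval (scale_higher t k) f =
  \sum_(m <- msupp f | higher_monom m)
    f@_m * cmon k m * \prod_i t i ^+ mndeg m i.
Proof.
rewrite cevalE [RHS]big_mkcond /=; apply: eq_bigr => m _.
case: ifPn => hm.
  rewrite cmon_change // mulrA; congr (_ * _).
  by apply: eq_bigr => i _; rewrite opprK subrK.
rewrite cmon_eq0 ?mulr0 // => i.
by rewrite change_values1 opprK subrK subrr.
Qed.

(** Both changes have all differences equal to 1: only first cumulants move, to 0 and back. *)
Lemma scale_higherK k :
  change_values (fun i => 1 + k (singleton_cidx i))
    (fun i => k (singleton_cidx i)) (scale_higher (fun=> 1) k) = k.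
Proof.
apply/ffunP => I; case: (cidxP I) => [[i ->]|hI].
  by rewrite !change_values1 mul1r opprK subrK addrK mul1r mul1r subrr add0r.
rewrite !change_values_higher // !big1 ?mulr1 // => i _.
  by rewrite addrK.
by rewrite opprK subrK.
Qed.

Definition higher_component (d : {ffun 'I_n -> nat}) f : cpoly R n :=
  \sum_(m <- msupp f | higher_monom m && (mndeg m == d)) f@_m *: 'X_[m].

Lemma ceval_higher_component d f k :
  ceval k (higher_component d f) =
  \sum_(m <- msupp f | higher_monom m && (mndeg m == d)) f@_m * cmon k m.
Proof.
rewrite /ceval /higher_component (raddf_sum (meval _)).
by apply: eq_bigr => m _; rewrite /= mevalZ mevalX.
Qed.

Lemma msupp_higher_component d f m :
  m \in msupp (higher_component d f) -> higher_monom m /\ mndeg m = d.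
Proof.
move=> /msupp_sum_le/flattenP[ms /mapP[m' + ->]].
rewrite mem_filter => /andP[/andP[hm /eqP dm] _] /msuppZ_le.
by rewrite msuppX inE => /eqP ->.
Qed.

Lemma higher_component_higher d f : in_higher_cumulants (higher_component d f).
Proof.
by move=> m /msupp_higher_component[/forallP hm _] j /(implyP (hm j)).
Qed.

Lemma higher_component_homogeneous d f : chomogeneous (higher_component d f).
Proof.
exists (\row_i (d i)%:Z) => m /msupp_higher_component[_ <-].
exact: mcdegE.
Qed.

Lemma zero_locus_invariant (S : set (cpoly R n)) :
  (forall f, S f -> in_higher_cumulants f /\ chomogeneous f) ->
  value_invariant (zero_locus S).
Proof.
move=> hS a b _ [k Vk <-] f Sf; have [hf [d df]] := hS f Sf.
have fk := Vk f Sf; rewrite cevalE in fk; rewrite cevalE.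
(* Any monomial [m0] of [f] provides natural exponents for the common scaling factor, since [d] has
   integer entries. *)
case E : (msupp f) => [|m0 s]; first by rewrite big_nil.
have m0f : m0 \in msupp f by rewrite E mem_head.
rewrite -E -[RHS](mul0r (\prod_i (a i - b i) ^+ mndeg m0 i)) -[in RHS]fk mulr_suml.
apply: eq_big_seq => m mf; rewrite cmon_change ?mulrA; last first.
  by apply/forallP => j; apply/implyP; apply: hf.
by rewrite (@mndeg_mcdeg m m0) // !df.
Qed.

Lemma value_invariant_change (V : set (cspace R n)) a b k :
  value_invariant V -> V k -> V (change_values a b k).
Proof. by move=> iV Vk; apply: (iV a b); exists k. Qed.

(** For [k] in [V] every [scale_higher t k] stays in [V], so [f] there is a polynomial in [t] that
    is identically zero. *)
Lemma higher_component_vanish (V : set (cspace R n)) f d :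
  value_invariant V -> (forall k, V k -> ceval k f = 0) ->
  forall k, V k -> ceval k (higher_component d f) = 0.
Proof.
move=> iV f0 k Vk; rewrite ceval_higher_component.
apply: monomial_sum_fiber_eq0 => t; rewrite -ceval_scale_higher; apply: f0.
exact: value_invariant_change Vk.
Qed.

End HigherCumulants.

Theorem theorem3p1 (R : realType) (n : nat) (V : set (cspace R n))
    (hV : subvariety V) :
  value_invariant V <->
  exists S : set (cpoly R n),
    (forall f, S f -> in_higher_cumulants f /\ chomogeneous f) /\
    V = zero_locus S.
Proof.
split=> [iV|[S [hS ->]]]; last exact: zero_locus_invariant.
have [S0 VS0] := hV.
exists [set g | exists2 f, S0 f & exists d, g = higher_component d f]%classic.
split=> [_ [f _ [d ->]]|].
  by split; [apply: higher_component_higher | apply: higher_component_homogeneous].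
apply/seteqP; split=> [k Vk _ [f S0f [d ->]]|k Zk].
  apply: (higher_component_vanish _ iV _ Vk) => k'.
  by rewrite VS0; apply.
(* By invariance it suffices that [k] with its first cumulants set to 0 lies in [V]. *)
rewrite -(scale_higherK k); apply: value_invariant_change => //.
rewrite VS0 => f S0f; rewrite ceval_scale_higher.
(* Grouped by multidegree, the value of [f] at that point is the sum of its components at [k]. *)
apply: (@sum_fibers_eq0 _ _ _ _ _ (@mndeg n)) => d.
rewrite -[RHS](Zk (higher_component d f)); last by exists f => //; exists d.
rewrite ceval_higher_component; apply: eq_bigr => m _.
by rewrite [X in _ * X]big1 ?mulr1 // => i _; rewrite expr1n.
Qed.
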